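(* Let $(T,\le)$ be a tree with $\omega$ levels, all finite, with $k$th level $L_k$. Then there is a sequence of ordered partitions $((\pi_k,<):k\in\omega)$ such that $\pi_k$ is a partition of $L_k$, and such that for any $k \in \omega$, $X\in\pi_k$ and $Y\in\pi_{k+1}$ there is $n(X,Y)\in\omega$ such that for each $x\in X$ the number of successors of $x$ lying in $Y$ is equal to $n(X,Y)$.
   Context: The axiom of choice is not assumed (work in ZF, or in ZF with atoms). A tree here is a well-founded tree: a partially ordered set $(T,\le)$ with a least element (root) in which $\{y\in T:y\le x\}$ is well-ordered for every $x\in T$. Its levels are defined recursively: $L_\alpha$ is the set of minimal elements of $T\setminus\bigcup_{\beta<\alpha}L_\beta$; it has $\omega$ levels if $\omega$ is the least ordinal $\alpha$ with $L_\alpha=\emptyset$. Successors of $x$ are immediate successors. An ordered partition $(\pi,<)$ of a set is a partition $\pi$ of the set into nonempty pieces together with a linear ordering $<$ of the set of pieces. *)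

(* Defs.v *)
(** The theorem is about what is provable without the axiom of choice.  Rocq's
    ambient logic cannot express that: as soon as a choice principle is assumed
    there, one could order every level and partition it into singletons.  We
    therefore take an arbitrary first-order model [M] of ZFA (set theory with a
    set of atoms, without choice) and assert that the theorem holds inside [M];
    by completeness this says that the theorem is provable in ZFA.  All objects
    of the theorem (sets, relations, functions, numbers) are elements of [M],
    and choice in the metatheory does not give choice functions in [M].  Models
    of ZF are those in which [atoms] has no elements. *)

Set Implicit Arguments.
Unset Strict Implicit.

Record structure := Structure {
  carrier :> Type;
  mem : carrier -> carrier -> Prop;
  empty : carrier;
  atoms : carrier
}.

Arguments empty {s}.
Arguments atoms {s}.

Notation "x ∈ y" := (mem x y) (at level 70, no associativity).

(** First-order formulas in the language of [∈] and [=], with de Bruijn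
    variables.  The constants [empty] and [atoms] need no symbols here, since
    formulas are evaluated with arbitrary parameters. *)

Inductive formula : Type :=
| Mem (i j : nat)
| Eq (i j : nat)
| Bot
| Imp (p q : formula)
| And (p q : formula)
| Or (p q : formula)
| All (p : formula)
| Ex (p : formula).

Definition scons (M : Type) (x : M) (e : nat -> M) (n : nat) : M :=
  match n with O => x | S m => e m end.

Fixpoint sat (M : structure) (e : nat -> M) (p : formula) : Prop :=
  match p with
  | Mem i j => e i ∈ e j
  | Eq i j => e i = e j
  | Bot => False
  | Imp p q => sat e p -> sat e q
  | And p q => sat e p /\ sat e q
  | Or p q => sat e p \/ sat e q
  | All p => forall x : M, sat (scons x e) p
  | Ex p => exists x : M, sat (scons x e) p
  end.

Definition isset (M : structure) (x : M) : Prop := ~ x ∈ atoms.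

(** The axioms of ZFA, with [empty] and [atoms] as constants. *)

Record ZFA (M : structure) : Prop := {
  zfa_empty : forall x : M, ~ x ∈ empty;
  zfa_atoms : forall z : M,
    z ∈ atoms <-> z <> empty /\ ~ exists x : M, x ∈ z;
  zfa_extensionality : forall x y : M, isset x -> isset y ->
    (forall u : M, u ∈ x <-> u ∈ y) -> x = y;
  zfa_pairing : forall x y : M,
    exists z : M, forall u : M, u ∈ z <-> u = x \/ u = y;
  zfa_union : forall s : M,
    exists z : M, forall u : M, u ∈ z <-> exists2 x : M, x ∈ s & u ∈ x;
  zfa_power : forall s : M,
    exists z : M, forall x : M,
      x ∈ z <-> isset x /\ forall u : M, u ∈ x -> u ∈ s;
  zfa_separation : forall (p : formula) (e : nat -> M) (s : M),
    exists z : M, forall x : M, x ∈ z <-> x ∈ s /\ sat (scons x e) p;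
  zfa_replacement : forall (p : formula) (e : nat -> M) (s : M),
    (forall x y z : M, x ∈ s -> sat (scons x (scons y e)) p ->
       sat (scons x (scons z e)) p -> y = z) ->
    exists t : M, forall y : M,
      y ∈ t <-> exists2 x : M, x ∈ s & sat (scons x (scons y e)) p;
  zfa_infinity : exists w : M, empty ∈ w /\
    forall x : M, x ∈ w ->
      exists2 y : M, y ∈ w & forall u : M, u ∈ y <-> u ∈ x \/ u = x;
  zfa_regularity : forall s : M, (exists x : M, x ∈ s) ->
    exists2 x : M, x ∈ s & forall y : M, y ∈ x -> ~ y ∈ s
}.

(** ** Relations and functions, as sets of Kuratowski pairs *)

Definition is_upair (M : structure) (z x y : M) : Prop :=
  forall u : M, u ∈ z <-> u = x \/ u = y.

Definition is_opair (M : structure) (p x y : M) : Prop :=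
  forall u : M, u ∈ p <-> is_upair u x x \/ is_upair u x y.

(** For a function [r], [related r x y] says that [r] maps [x] to [y]. *)
Definition related (M : structure) (r x y : M) : Prop :=
  exists2 p : M, p ∈ r & is_opair p x y.

Definition relation_on (M : structure) (a r : M) : Prop :=
  isset r /\
  forall p : M, p ∈ r -> exists x y : M, x ∈ a /\ y ∈ a /\ is_opair p x y.

Definition function_on (M : structure) (d f : M) : Prop :=
  isset f /\
  (forall p : M, p ∈ f -> exists x y : M, x ∈ d /\ is_opair p x y) /\
  (forall x : M, x ∈ d -> exists! y : M, related f x y).

Definition bijection (M : structure) (a b f : M) : Prop :=
  function_on a f /\
  (forall x y : M, related f x y -> y ∈ b) /\
  (forall y : M, y ∈ b -> exists! x : M, related f x y).

(** ** Natural numbers, as von Neumann ordinals *)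

Definition is_succ (M : structure) (y x : M) : Prop :=
  forall u : M, u ∈ y <-> u ∈ x \/ u = x.

Definition inductive (M : structure) (w : M) : Prop :=
  empty ∈ w /\ forall x y : M, x ∈ w -> is_succ y x -> y ∈ w.

Definition is_omega (M : structure) (w : M) : Prop :=
  inductive w /\
  forall w' : M, inductive w' -> forall x : M, x ∈ w -> x ∈ w'.

Definition has_card (M : structure) (s n : M) : Prop :=
  exists f : M, bijection s n f.

Definition finite (M : structure) (omega s : M) : Prop :=
  exists2 n : M, n ∈ omega & has_card s n.

(** ** Trees and their levels *)

Definition partial_order (M : structure) (T le : M) : Prop :=
  relation_on T le /\
  (forall x : M, x ∈ T -> related le x x) /\
  (forall x y : M, related le x y -> related le y x -> x = y) /\
  (forall x y z : M, related le x y -> related le y z -> related le x z).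

Definition well_ordered (M : structure) (d le : M) : Prop :=
  (forall x y : M, x ∈ d -> y ∈ d -> related le x y \/ related le y x) /\
  (forall s : M, (forall x : M, x ∈ s -> x ∈ d) -> (exists x : M, x ∈ s) ->
     exists2 x : M, x ∈ s & forall y : M, y ∈ s -> related le x y).

Definition tree (M : structure) (T le : M) : Prop :=
  partial_order T le /\
  (exists2 r : M, r ∈ T & forall x : M, x ∈ T -> related le r x) /\
  (forall x d : M, x ∈ T ->
     (forall y : M, y ∈ d <-> y ∈ T /\ related le y x) -> well_ordered d le).

(** [unplaced T L a x] says that [x] is in [T] minus the union of the [L b] for
    [b ∈ a]. *)
Definition unplaced (M : structure) (T L a x : M) : Prop :=
  x ∈ T /\ ~ exists b l : M, b ∈ a /\ related L b l /\ x ∈ l.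

(** [L] is the sequence of levels of the tree, indexed by the ordinal [d]. *)
Definition level_sequence (M : structure) (T le d L : M) : Prop :=
  function_on d L /\
  forall a l : M, a ∈ d -> related L a l ->
    isset l /\
    forall x : M, x ∈ l <->
      unplaced T L a x /\
      forall y : M, unplaced T L a y -> related le y x -> y = x.

(** [L] lists the levels with index up to and including [omega], and [omega] is
    the first index at which the level is empty. *)
Definition omega_levels (M : structure) (omega T le L : M) : Prop :=
  (exists2 d : M, is_succ d omega & level_sequence T le d L) /\
  related L omega empty /\
  forall k : M, k ∈ omega -> ~ related L k empty.

Definition immediate_successor (M : structure) (T le x y : M) : Prop :=
  x ∈ T /\ y ∈ T /\ related le x y /\ x <> y /\
  forall z : M, related le x z -> related le z y -> z = x \/ z = y.

(** ** Ordered partitions *)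

Definition partition (M : structure) (s P : M) : Prop :=
  isset P /\
  (forall X : M, X ∈ P ->
     (exists x : M, x ∈ X) /\ forall x : M, x ∈ X -> x ∈ s) /\
  (forall x : M, x ∈ s -> exists! X : M, X ∈ P /\ x ∈ X).

Definition strict_linear_order (M : structure) (a lt : M) : Prop :=
  relation_on a lt /\
  (forall x : M, ~ related lt x x) /\
  (forall x y z : M, related lt x y -> related lt y z -> related lt x z) /\
  (forall x y : M, x ∈ a -> y ∈ a ->
     related lt x y \/ x = y \/ related lt y x).

Definition ordered_partition (M : structure) (s P lt : M) : Prop :=
  partition s P /\ strict_linear_order P lt.

(* Main.v *)
From Stdlib Require Import Classical PeanoNat.
Require Import Defs.

(** Choose the partition as coarse as possible and its ordering comes for free:
    two nodes of the same level are put in one piece when no counting of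
    successors can tell them apart, and the differences found by counting
    compare the others.

    Concretely, all the levels are handled by a single total preorder on the set
    of nodes.  Start with the preorder [level_le] that compares levels.  Given a
    total preorder [R], let [step] refine it by comparing [R]-equivalent nodes
    [x] and [y] lexicographically ([lex_le]): look for the first [R]-class in
    which [x] and [y] have different numbers of successors, and compare these
    numbers.  A first such class exists because levels are finite and [R] refines
    the comparison of levels ([preorder_minimum]); so the result is again a total
    preorder ([step_total_preorder]).  Intersections of chains of total preorders
    are total preorders ([meet_total_preorder]).  Hence iterating [step] and
    taking intersections of what has been obtained so far leads to a total
    preorder [R] with [step R R], and the latter means that [R]-equivalent nodes
    have the same number of successors in every [R]-class
    ([fixed_uniform_count]).  The pieces of the level [k] are the [R]-classes in
    it, ordered by [R].  Everything is determined by the tree, so no choices are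
    made.

    The argument takes place inside a model whose natural numbers may be
    nonstandard, so the iteration cannot be indexed from outside.  Instead of a
    recursion inside the model, [deflationary_fixpoint] uses the smallest family
    closed under [step] and intersections, as in Zermelo's proof of the
    well-ordering theorem: it is a chain, and its intersection is a fixed point.

    Separation, replacement and induction are available only for properties
    given by formulas.  The predicate [definable] collects these properties,
    with parameters, and the tactic [definability] establishes it by following
    the syntax of the property. *)

(** * Definability with parameters *)

Section Definability.

Variable M : structure.
Implicit Types (p q : formula) (e : nat -> M).

Definition up (f : nat -> nat) (n : nat) : nat :=
  match n with O => O | S m => S (f m) end.

Fixpoint rename (f : nat -> nat) (p : formula) : formula :=
  match p with
  | Mem i j => Mem (f i) (f j)
  | Eq i j => Eq (f i) (f j)
  | Bot => Bot
  | Imp p q => Imp (rename f p) (rename f q)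
  | And p q => And (rename f p) (rename f q)
  | Or p q => Or (rename f p) (rename f q)
  | All p => All (rename (up f) p)
  | Ex p => Ex (rename (up f) p)
  end.

Lemma sat_rename p : forall (f : nat -> nat) e e',
  (forall n, e n = e' (f n)) -> (sat e p <-> sat e' (rename f p)).
Proof.
  induction p as [i j|i j| |p IHp q IHq|p IHp q IHq|p IHp q IHq|p IHp|p IHp];
    intros f e e' He; cbn.
  1,2: now rewrite !He.
  1: tauto.
  1,2,3: now rewrite (IHp f e e' He), (IHq f e e' He).
  - split; intros H x; apply (IHp (up f) (scons x e) (scons x e')); auto;
      intros [|n]; cbn; auto.
  - split; intros [x H]; exists x; apply (IHp (up f) (scons x e) (scons x e')); auto;
      intros [|n]; cbn; auto.
Qed.

Definition value e (a : nat + M) : M :=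
  match a with inl i => e i | inr c => c end.

(** Properties of assignments expressible by a formula in which each variable is
    interpreted by an entry of the assignment or by a fixed parameter. *)
Definition definable (P : (nat -> M) -> Prop) : Prop :=
  exists p (r : nat -> nat + M), forall e, P e <-> sat (fun n => value e (r n)) p.

Definition term (t : (nat -> M) -> M) : Prop :=
  exists a, forall e, t e = value e a.

Lemma term_var n : term (fun e => e n).
Proof. now exists (inl n). Qed.

Lemma term_const (c : M) : term (fun _ => c).
Proof. now exists (inr c). Qed.

Lemma def_mem t u : term t -> term u -> definable (fun e => t e ∈ u e).
Proof.
  intros [a Ha] [b Hb].
  exists (Mem 0 1), (fun n => match n with O => a | _ => b end).
  intros e; cbn; now rewrite Ha, Hb.
Qed.

Lemma def_eq t u : term t -> term u -> definable (fun e => t e = u e).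
Proof.
  intros [a Ha] [b Hb].
  exists (Eq 0 1), (fun n => match n with O => a | _ => b end).
  intros e; cbn; now rewrite Ha, Hb.
Qed.

(** A proposition not depending on the environment needs no translation: by
    excluded middle it is [True] or [False]. *)
Lemma def_prop (A : Prop) : definable (fun _ => A).
Proof.
  destruct (classic A).
  - exists (Imp Bot Bot), inl; cbn; tauto.
  - exists Bot, inl; cbn; tauto.
Qed.

(** Two formulas with different parameters are put over a common assignment by
    using the even variables for the one and the odd variables for the other. *)
Lemma def_common P Q : definable P -> definable Q ->
  exists p q (r : nat -> nat + M), forall e,
    (P e <-> sat (fun n => value e (r n)) p) /\
    (Q e <-> sat (fun n => value e (r n)) q).
Proof.
  intros [p [r Hp]] [q [s Hq]].
  exists (rename (fun n => 2 * n) p), (rename (fun n => S (2 * n)) q),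
    (fun n => if Nat.even n then r (Nat.div2 n) else s (Nat.div2 n)).
  intros e; rewrite Hp, Hq; split; apply sat_rename; intros n.
  - now rewrite Nat.even_even, Nat.div2_double.
  - now rewrite Nat.even_succ, Nat.odd_even, Nat.div2_succ_double.
Qed.

Lemma def_imp P Q : definable P -> definable Q -> definable (fun e => P e -> Q e).
Proof.
  intros HP HQ; destruct (def_common _ _ HP HQ) as (p & q & r & H).
  exists (Imp p q), r; intros e; cbn; specialize (H e); tauto.
Qed.

Lemma def_and P Q : definable P -> definable Q -> definable (fun e => P e /\ Q e).
Proof.
  intros HP HQ; destruct (def_common _ _ HP HQ) as (p & q & r & H).
  exists (And p q), r; intros e; cbn; specialize (H e); tauto.
Qed.

Lemma def_or P Q : definable P -> definable Q -> definable (fun e => P e \/ Q e).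
Proof.
  intros HP HQ; destruct (def_common _ _ HP HQ) as (p & q & r & H).
  exists (Or p q), r; intros e; cbn; specialize (H e); tauto.
Qed.

(** Abstracting variable 0: occurrences of it become the bound variable, all
    other entries of the assignment move up by one. *)
Lemma def_bind (Q : M -> (nat -> M) -> Prop) :
  definable (fun e => Q (e 0) (fun n => e (S n))) ->
  exists p (r : nat -> nat + M), forall x e,
    Q x e <-> sat (scons x (fun n => value e (r n))) p.
Proof.
  intros [p [r H]].
  exists (rename (fun n => match r n with inl O => O | _ => S n end) p),
    (fun n => match r n with inl (S i) => inl i | a => a end).
  intros x e.
  rewrite (H (scons x e) : Q x e <-> _).
  apply sat_rename; intros n.
  now destruct (r n) as [[|i]|c] eqn:E; cbn; rewrite ?E.
Qed.

Lemma def_all (Q : M -> (nat -> M) -> Prop) :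
  definable (fun e => Q (e 0) (fun n => e (S n))) ->
  definable (fun e => forall x, Q x e).
Proof.
  intros HQ; destruct (def_bind Q HQ) as (p & r & H).
  exists (All p), r; intros e; cbn.
  split; intros K x; apply H; auto.
Qed.

Lemma def_ex (Q : M -> (nat -> M) -> Prop) :
  definable (fun e => Q (e 0) (fun n => e (S n))) ->
  definable (fun e => exists x, Q x e).
Proof.
  intros HQ; destruct (def_bind Q HQ) as (p & r & H).
  exists (Ex p), r; intros e; cbn.
  split; intros [x K]; exists x; apply H; auto.
Qed.

Lemma def_ex2 (P Q : M -> (nat -> M) -> Prop) :
  definable (fun e => P (e 0) (fun n => e (S n)) /\ Q (e 0) (fun n => e (S n))) ->
  definable (fun e => exists2 x, P x e & Q x e).
Proof.
  intros H; destruct (def_ex (fun x e => P x e /\ Q x e) H) as (p & r & K).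
  exists p, r; intros e; rewrite <- K.
  split; [intros [x]|intros (x & ? & ?)]; eauto.
Qed.

Definition definable2 (A : M -> M -> Prop) := definable (fun e => A (e 0) (e 1)).

Lemma def_apply2 A t u : definable2 A -> term t -> term u ->
  definable (fun e => A (t e) (u e)).
Proof.
  intros [p [r H]] [a Ha] [b Hb].
  exists p, (fun n => match r n with inl O => a | inl _ => b | c => c end).
  intros e; rewrite Ha, Hb.
  rewrite (H (scons (value e a) (fun _ => value e b)) : A _ _ <-> _).
  enough (E : forall e1 e2, (forall n, e1 n = e2 n :> M) -> sat e1 p -> sat e2 p).
  { split; apply E; intros n; now destruct (r n) as [[|i]|c]. }
  clear; intros e1 e2 E K.
  assert (R := sat_rename p (fun n => n) e1 e2 E).
  assert (R' := sat_rename p (fun n => n) e2 e2 (fun n => eq_refl)).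
  tauto.
Qed.

(** The axiom schemes evaluate formulas at assignments that begin with one or two
    bound variables, the rest being parameters; [d] fills the places that the
    property does not look at. *)
Lemma def_formula P : definable P ->
  exists p c, forall x y d,
    P (scons x (scons y (fun _ => d))) <-> sat (scons x (scons y (scons d c))) p.
Proof.
  intros [p [r H]].
  exists (rename (fun n => match r n with inl O => 0 | inl 1 => 1 | inl _ => 2
                          | inr _ => S (S (S n)) end) p),
    (fun n => match r n with inl _ => empty | inr c => c end).
  intros x y d; rewrite H; apply sat_rename; intros n.
  now destruct (r n) as [[|[|i]]|c] eqn:E; cbn; rewrite ?E.
Qed.

End Definability.

Arguments term {M}.
Arguments definable {M}.
Arguments definable2 {M}.

(* The last case serves notations and defined predicates: [apply] unfolds them
   as far as necessary to expose a connective. *)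
Ltac definability :=
  intros; cbv beta; unfold definable2;
  repeat (cbv beta; first
    [ assumption
    | lazymatch goal with
      | |- term _ => first [apply term_var | apply term_const]
      | |- definable (fun _ => ?A) => apply def_prop
      | |- definable (fun e => mem _ _) => apply def_mem
      | |- definable (fun e => _ = _) => apply def_eq
      | |- definable (fun e => _ /\ _) => apply def_and
      | |- definable (fun e => _ \/ _) => apply def_or
      | |- definable (fun e => ex _) => apply def_ex
      | |- definable (fun e => ex2 _ _) => apply def_ex2
      | H : definable2 ?A |- definable (fun e => ?A _ _) => apply (@def_apply2 _ A _ _ H)
      | |- _ => first [apply def_imp | apply def_all | apply def_mem | apply def_and
                      | apply def_or | apply def_ex | apply def_ex2]
      end ]).

(** * Sets, pairs and relations *)

Definition subset {M : structure} (x y : M) : Prop := forall u : M, u ∈ x -> u ∈ y.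

Section Sets.

Variables (M : structure) (HM : ZFA M).
Implicit Types (a b d f p r s x y z : M) (P : M -> Prop) (A : M -> M -> Prop).

Lemma isset_inhabited x s : x ∈ s -> isset s.
Proof. intros H K; apply (zfa_atoms HM) in K; destruct K; eauto. Qed.

Lemma isset_empty : isset (@empty M).
Proof. intros K; apply (zfa_atoms HM) in K; now destruct K. Qed.

(** The existence axioms determine the members of an object, but when there are
    none, the object may be an atom. *)
Lemma set_of_members s : exists z, isset z /\ forall x, x ∈ z <-> x ∈ s.
Proof.
  destruct (classic (exists x, x ∈ s)) as [[x Hx]|H].
  - exists s; split; [now apply (isset_inhabited x)|tauto].
  - exists empty; split; [apply isset_empty|].
    intros x; split; intros K; [now apply (zfa_empty HM) in K|destruct H; eauto].
Qed.

Lemma comprehension P s : definable (fun e => P (e 0)) ->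
  exists z, isset z /\ forall x, x ∈ z <-> x ∈ s /\ P x.
Proof.
  intros H; destruct (def_formula _ _ H) as (p & c & Hp).
  destruct (zfa_separation HM p (scons empty (scons empty c)) s) as [z Hz].
  destruct (set_of_members z) as (z' & Hset & Hz').
  exists z'; split; [easy|intros x].
  now rewrite Hz', Hz, <- Hp.
Qed.

Lemma replacement A s : definable2 A ->
  (forall x y y', x ∈ s -> A x y -> A x y' -> y = y') ->
  exists z, isset z /\ forall y, y ∈ z <-> exists2 x, x ∈ s & A x y.
Proof.
  intros H Hfun; destruct (def_formula _ _ H) as (p & c & Hp).
  destruct (@zfa_replacement M HM p (scons empty c) s) as [z Hz].
  - intros x y y' Hx; rewrite <- !Hp; now apply Hfun.
  - destruct (set_of_members z) as (z' & Hset & Hz').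
    exists z'; split; [easy|intros y]; rewrite Hz', Hz.
    split; intros [x Hx K]; exists x; trivial; revert K; now rewrite <- Hp.
Qed.

Lemma set_ext x y : isset x -> isset y -> subset x y -> subset y x -> x = y.
Proof. intros Hx Hy H K; apply (zfa_extensionality HM); firstorder. Qed.

Lemma union_exists a b :
  exists z, forall x, x ∈ z <-> x ∈ a \/ x ∈ b.
Proof.
  destruct (zfa_pairing HM a b) as [c Hc], (zfa_union HM c) as [z Hz].
  exists z; intros x; rewrite Hz; split.
  - intros [u Hu Hx]; apply Hc in Hu; destruct Hu; subst; tauto.
  - intros [H|H]; [exists a|exists b]; trivial; apply Hc; tauto.
Qed.

Lemma upair_unique z z' x y : is_upair z x y -> is_upair z' x y -> z = z'.
Proof.
  intros H H'; apply set_ext.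
  1,2: apply (isset_inhabited x); firstorder.
  all: intros u; rewrite (H u), (H' u); tauto.
Qed.

Lemma opair_exists x y : exists p, is_opair p x y.
Proof.
  destruct (zfa_pairing HM x x) as [a Ha], (zfa_pairing HM x y) as [b Hb],
    (zfa_pairing HM a b) as [p Hp].
  exists p; intros u; rewrite (Hp u).
  split; (intros [H|H]; [left|right]); try (now subst); eapply upair_unique; eauto.
Qed.

Lemma opair_unique p p' x y : is_opair p x y -> is_opair p' x y -> p = p'.
Proof.
  intros H H'; destruct (zfa_pairing HM x x) as [a Ha].
  apply set_ext.
  1,2: apply (isset_inhabited a); firstorder.
  all: intros u; rewrite (H u), (H' u); tauto.
Qed.

Lemma opair_inj p x y x' y' : is_opair p x y -> is_opair p x' y' -> x = x' /\ y = y'.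
Proof.
  intros H H'.
  destruct (zfa_pairing HM x x) as [a Ha], (zfa_pairing HM x y) as [b Hb],
    (zfa_pairing HM x' x') as [a' Ha'], (zfa_pairing HM x' y') as [b' Hb'].
  assert (Ka : a ∈ p) by (apply H; auto).
  assert (Kb : b ∈ p) by (apply H; auto).
  assert (Ka' : a' ∈ p) by (apply H'; auto).
  assert (Kb' : b' ∈ p) by (apply H'; auto).
  apply H' in Ka; apply H' in Kb; apply H in Ka'; apply H in Kb'.
  unfold is_upair in *.
  assert (Ex : x = x').
  { destruct Ka as [K|K].
    - assert (J := proj1 (K x)); rewrite (Ha x) in J; firstorder.
    - assert (J := proj2 (K x')); rewrite (Ha x') in J; firstorder. }
  subst x'; split; trivial.
  assert (Ey : y = x \/ y = y').
  { destruct Kb as [K|K]; assert (J := proj1 (K y)); rewrite (Hb y) in J; tauto. }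
  assert (Ey' : y' = x \/ y' = y).
  { destruct Kb' as [K|K]; assert (J := proj1 (K y')); rewrite (Hb' y') in J; tauto. }
  destruct Ey as [->| ->]; trivial; destruct Ey' as [->| ->]; trivial.
Qed.

Lemma opair_related r p x y : is_opair p x y -> (p ∈ r <-> related r x y).
Proof.
  intros H; split; [now exists p|intros [p' H' K]].
  now rewrite (opair_unique p p' x y).
Qed.

Lemma relation_comprehension A a b : definable2 A ->
  exists r, isset r /\
    (forall p, p ∈ r -> exists x y, x ∈ a /\ y ∈ b /\ is_opair p x y) /\
    (forall x y, related r x y <-> x ∈ a /\ y ∈ b /\ A x y).
Proof.
  intros HA.
  destruct (union_exists a b) as [c Hc], (zfa_power HM c) as [d Hd],
    (zfa_power HM d) as [s Hs].
  destruct (comprehension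
    (fun p => exists x y, x ∈ a /\ y ∈ b /\ is_opair p x y /\ A x y) s)
    as (r & Hr & Hr').
  { definability. }
  exists r; split; [trivial|split].
  { intros p Hp; apply Hr' in Hp; destruct Hp as (_ & x & y & Hp); exists x, y; tauto. }
  intros x y; split.
  - intros [p Hp K]; apply Hr' in Hp; destruct Hp as (_ & x' & y' & Hx & Hy & Hp & HA').
    destruct (opair_inj p x y x' y'); trivial; now subst.
  - intros (Hx & Hy & K); destruct (opair_exists x y) as [p Hp].
    exists p; trivial; apply Hr'; split; [|now exists x, y].
    destruct (zfa_pairing HM x x) as [u Hu].
    assert (forall v, v ∈ p -> subset v c /\ isset v).
    { intros v Hv; apply Hp in Hv; split.
      - intros w Hw; apply Hc; destruct Hv as [Hv|Hv]; apply Hv in Hw;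
          destruct Hw; subst; tauto.
      - apply (isset_inhabited x); destruct Hv as [Hv|Hv]; apply Hv; auto. }
    apply Hs; split.
    + apply (isset_inhabited u), Hp; auto.
    + intros v Hv; apply Hd; now apply and_comm, H.
Qed.

Lemma function_of_class A d :
  definable2 A -> (forall x, x ∈ d -> exists! y, A x y) ->
  exists f, function_on d f /\ forall x y, related f x y <-> x ∈ d /\ A x y.
Proof.
  intros HA Hfun.
  assert (Huniq : forall x y y', x ∈ d -> A x y -> A x y' -> y = y').
  { intros x y y' Hx H H'; destruct (Hfun x Hx) as (z & _ & Hz).
    now rewrite <- (Hz y), <- (Hz y'). }
  destruct (replacement (fun x p => exists2 y, A x y & is_opair p x y) d)
    as (f & Hset & Hf).
  { definability. }
  { intros x p p' Hx [y Hy Hp] [y' Hy' Hp'].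
    rewrite (Huniq x y' y) in Hp' by trivial; now apply (opair_unique p p' x y). }
  assert (Hrel : forall x y, related f x y <-> x ∈ d /\ A x y).
  { intros x y; split.
    - intros [p Hp K]; apply Hf in Hp; destruct Hp as [x' Hx' [y' HA' K']].
      now destruct (opair_inj p x y x' y' K K') as [-> ->].
    - intros [Hx HA']; destruct (opair_exists x y) as [p Hp].
      exists p; trivial; apply Hf; exists x; eauto. }
  exists f; split; [split; [trivial|split]|trivial].
  - intros p Hp; apply Hf in Hp; destruct Hp as [x Hx [y _ K]]; eauto.
  - intros x Hx; destruct (Hfun x Hx) as (y & Hy & _); exists y; split.
    + now apply Hrel.
    + intros y' Hy'; apply Hrel in Hy'; now apply (Huniq x).
Qed.

Lemma related_subset r r' x y : subset r r' -> related r x y -> related r' x y.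
Proof. intros H [p Hp K]; exists p; auto. Qed.

Lemma bijection_intro A a b : definable2 A ->
  (forall x, x ∈ a -> exists2 y, y ∈ b & A x y) ->
  (forall y, y ∈ b -> exists2 x, x ∈ a & A x y) ->
  (forall x y y', A x y -> A x y' -> y = y') ->
  (forall x x' y, A x y -> A x' y -> x = x') ->
  exists f, bijection a b f.
Proof.
  intros HA Htot Hsurj Hfun Hinj.
  destruct (relation_comprehension A a b HA) as (f & Hset & Hp & Hf).
  exists f; split; [split; [trivial|split]|split].
  - intros p K; apply Hp in K; destruct K as (x & y & Hx & _ & K); eauto.
  - intros x Hx; destruct (Htot x Hx) as [y Hy K]; exists y; split.
    + now apply Hf.
    + intros y' K'; apply Hf in K'; apply (Hfun x); tauto.
  - intros x y K; apply Hf in K; tauto.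
  - intros y Hy; destruct (Hsurj y Hy) as [x Hx K]; exists x; split.
    + now apply Hf.
    + intros x' K'; apply Hf in K'; apply (Hinj _ _ y); tauto.
Qed.

Lemma bijection_elim a b f : bijection a b f ->
  (forall x, x ∈ a -> exists2 y, y ∈ b & related f x y) /\
  (forall y, y ∈ b -> exists2 x, x ∈ a & related f x y) /\
  (forall x y y', related f x y -> related f x y' -> y = y') /\
  (forall x x' y, related f x y -> related f x' y -> x = x') /\
  (forall x y, related f x y -> x ∈ a /\ y ∈ b).
Proof.
  intros [(Hset & Hp & Hfun) [Hran Hinv]].
  assert (Hdom : forall x y, related f x y -> x ∈ a).
  { intros x y [p Hpf K]; destruct (Hp p Hpf) as (x' & y' & Hx & K').
    destruct (opair_inj p x y x' y'); trivial; now subst. }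
  repeat split; eauto.
  - intros x Hx; destruct (Hfun x Hx) as (y & Hy & _); eauto.
  - intros y Hy; destruct (Hinv y Hy) as (x & Hx & _); eauto.
  - intros x y y' K K'; destruct (Hfun x) as (z & _ & Hz); eauto.
    now rewrite <- (Hz y), <- (Hz y').
  - intros x x' y K K'; destruct (Hinv y) as (z & _ & Hz); eauto.
    now rewrite <- (Hz x), <- (Hz x').
Qed.

End Sets.

(** * Natural numbers and finite sets *)

Section Finite.

Variables (M : structure) (HM : ZFA M) (omega : M) (Homega : is_omega omega).
Implicit Types (a b d f k m n p r s x y z : M) (P : M -> Prop).

Lemma succ_exists x : exists y, is_succ y x.
Proof.
  destruct (zfa_pairing HM x x) as [a Ha], (union_exists M HM x a) as [y Hy].
  exists y; intros u; rewrite Hy, Ha; tauto.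
Qed.

Lemma succ_unique x y y' : is_succ y x -> is_succ y' x -> y = y'.
Proof.
  intros H H'; apply (set_ext M HM).
  1,2: apply (isset_inhabited M HM x); firstorder.
  all: intros u; rewrite (H u), (H' u); tauto.
Qed.

Lemma empty_omega : empty ∈ omega.
Proof. apply (proj1 Homega). Qed.

Lemma succ_omega n n' : n ∈ omega -> is_succ n' n -> n' ∈ omega.
Proof. apply (proj1 Homega). Qed.

Lemma omega_induction P : definable (fun e => P (e 0)) -> P empty ->
  (forall n n', n ∈ omega -> P n -> is_succ n' n -> P n') ->
  forall n, n ∈ omega -> P n.
Proof.
  intros HP H0 HS n Hn.
  destruct (comprehension M HM P omega HP) as (w & _ & Hw).
  apply Hw; revert n Hn; apply Homega; split.
  - apply Hw; split; [apply empty_omega|trivial].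
  - intros n n' Hn Hsucc; apply Hw in Hn; apply Hw; split.
    + apply (succ_omega n); tauto.
    + apply (HS n); tauto.
Qed.

Lemma minimal_exists P s : definable (fun e => P (e 0)) ->
  (exists2 x, x ∈ s & P x) ->
  exists x, x ∈ s /\ P x /\ forall y, y ∈ s -> P y -> ~ y ∈ x.
Proof.
  intros HP [x Hx Hx'].
  destruct (comprehension M HM P s HP) as (a & _ & Ha).
  destruct (zfa_regularity HM (s := a)) as [y Hy Hmin].
  - exists x; now apply Ha.
  - apply Ha in Hy; exists y; split; [tauto|split; [tauto|]].
    intros z Hz Hz' K; apply (Hmin z K), Ha; tauto.
Qed.

Lemma mem_irrefl x : ~ x ∈ x.
Proof.
  intros H; destruct (minimal_exists (fun y => y = x) x) as (y & Hy & -> & Hmin).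
  - definability.
  - now exists x.
  - now apply (Hmin x).
Qed.

Lemma omega_transitive n : n ∈ omega -> forall m k, k ∈ m -> m ∈ n -> k ∈ n.
Proof.
  revert n; refine (omega_induction _ _ _ _); [definability| |].
  - intros m k _ H; now apply (zfa_empty HM) in H.
  - intros n n' _ IH H m k Hk Hm; apply H; apply H in Hm; left.
    destruct Hm as [Hm| ->]; eauto.
Qed.

Lemma omega_linear m n : m ∈ omega -> n ∈ omega -> m ∈ n \/ m = n \/ n ∈ m.
Proof.
  assert (Hzero : forall n, n ∈ omega -> empty ∈ n \/ empty = n).
  { refine (omega_induction _ _ _ _); [definability|auto|].
    intros k k' _ IH H; left; apply H; destruct IH; auto. }
  assert (Hsucc : forall n, n ∈ omega -> forall k k', k ∈ n -> is_succ k' k ->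
                    k' ∈ n \/ k' = n).
  { refine (omega_induction _ _ _ _); [definability| |].
    - intros k k' H; now apply (zfa_empty HM) in H.
    - intros i i' _ IH H k k' Hk Hk'; apply H in Hk; destruct Hk as [Hk| ->].
      + left; apply H; eapply IH; eauto.
      + right; eapply succ_unique; eauto. }
  intros Hm Hn; revert n Hn m Hm; apply (omega_induction (fun n => forall m,
    m ∈ omega -> m ∈ n \/ m = n \/ n ∈ m)); [definability| |].
  - intros m Hm; destruct (Hzero m Hm); auto.
  - intros n n' Hn IH H m Hm; destruct (IH m Hm) as [K|[->|K]].
    + left; apply H; auto.
    + left; apply H; auto.
    + destruct (Hsucc m Hm n n' K H); auto.
Qed.

Definition le_nat m n : Prop := m ∈ n \/ m = n.

Lemma le_nat_trans k m n : n ∈ omega -> le_nat k m -> le_nat m n -> le_nat k n.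
Proof.
  intros Hn [H| ->] [K| ->]; unfold le_nat; auto.
  left; eapply omega_transitive; eauto.
Qed.

Lemma le_nat_total m n : m ∈ omega -> n ∈ omega -> le_nat m n \/ le_nat n m.
Proof.
  intros Hm Hn; unfold le_nat; destruct (omega_linear m n) as [|[|]]; auto.
Qed.

Lemma le_nat_antisym m n : n ∈ omega -> le_nat m n -> le_nat n m -> m = n.
Proof.
  intros Hn [H|H] [K|K]; auto.
  now destruct (mem_irrefl n); apply (omega_transitive n Hn m).
Qed.

Lemma least_number P : definable (fun e => P (e 0)) ->
  (exists2 n, n ∈ omega & P n) ->
  exists n, n ∈ omega /\ P n /\ forall m, m ∈ omega -> P m -> le_nat n m.
Proof.
  intros HP H; destruct (minimal_exists P omega HP H) as (n & Hn & Hn' & Hmin).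
  exists n; repeat split; trivial; intros m Hm Hm'.
  destruct (omega_linear n m) as [|[|K]]; unfold le_nat; auto.
  now apply Hmin in K.
Qed.

Lemma has_card_ext s s' n : (forall u, u ∈ s <-> u ∈ s') -> has_card s n -> has_card s' n.
Proof.
  intros H [f Hf]; apply (bijection_elim M HM) in Hf.
  destruct Hf as (Htot & Hsurj & Hfun & Hinj & Hdom).
  apply (bijection_intro M HM (related f)); [definability| | |trivial|trivial].
  - intros x Hx; now apply Htot, H.
  - intros y Hy; destruct (Hsurj y Hy) as [x Hx K]; exists x; trivial; now apply H.
Qed.

Lemma finite_empty s : (forall u, ~ u ∈ s) -> finite omega s.
Proof.
  intros H; exists empty; [apply empty_omega|].
  apply (bijection_intro M HM (fun _ _ => False)); [definability| | |easy|easy].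
  - intros x Hx; now apply H in Hx.
  - intros x Hx; now apply (zfa_empty HM) in Hx.
Qed.

Lemma finite_add s s' x : finite omega s ->
  (forall u, u ∈ s' <-> u ∈ s \/ u = x) -> finite omega s'.
Proof.
  intros [n Hn Hcard] H; destruct (classic (x ∈ s)) as [Hx|Hx].
  { exists n; trivial; revert Hcard; apply has_card_ext.
    intros u; rewrite H; split; [tauto|]; intros [|E]; subst; auto. }
  destruct (succ_exists n) as [n' Hn'].
  exists n'; [now apply (succ_omega n)|].
  destruct Hcard as [f Hf]; apply (bijection_elim M HM) in Hf.
  destruct Hf as (Htot & Hsurj & Hfun & Hinj & Hdom).
  assert (Hnn := mem_irrefl n).
  apply (bijection_intro M HM (fun u v => related f u v \/ (u = x /\ v = n))).
  - definability.
  - intros u Hu; apply H in Hu; destruct Hu as [Hu| ->].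
    + destruct (Htot u Hu) as [v Hv K]; exists v; [apply Hn'|]; auto.
    + exists n; [apply Hn'|]; auto.
  - intros v Hv; apply Hn' in Hv; destruct Hv as [Hv| ->].
    + destruct (Hsurj v Hv) as [u Hu K]; exists u; [apply H|]; auto.
    + exists x; [apply H|]; auto.
  - intros u v v' [K|[-> ->]] [K'|[E ->]]; subst; eauto.
    + now destruct Hx; apply (Hdom x v).
    + now destruct Hx; apply (Hdom x v').
  - intros u u' v [K|[-> ->]] [K'|[-> E]]; subst; eauto.
    + now destruct Hnn; apply (Hdom u n).
    + now destruct Hnn; apply (Hdom u' n).
Qed.

(** A finite set is obtained from an empty one by adding elements: in a bijection
    with [n + 1], remove the element mapped to [n]. *)
Lemma finite_induction P : definable (fun e => P (e 0)) ->
  (forall s, (forall u, ~ u ∈ s) -> P s) ->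
  (forall s s' x, P s -> (forall u, u ∈ s' <-> u ∈ s \/ u = x) -> P s') ->
  forall s, finite omega s -> P s.
Proof.
  intros HP H0 HS.
  enough (K : forall n, n ∈ omega -> forall s, has_card s n -> P s).
  { intros s [n Hn Hs]; eauto. }
  refine (omega_induction _ _ _ _).
  - definability.
  - intros s [f Hf]; apply H0; intros u Hu.
    apply (bijection_elim M HM) in Hf; destruct Hf as (Htot & _).
    destruct (Htot u Hu) as [v Hv _]; now apply (zfa_empty HM) in Hv.
  - intros n n' Hn IH Hn' s [f Hf]; apply (bijection_elim M HM) in Hf.
    destruct Hf as (Htot & Hsurj & Hfun & Hinj & Hdom).
    destruct (Hsurj n) as [x Hx Hxn]; [apply Hn'; auto|].
    destruct (comprehension M HM (fun u => u <> x) s) as (t & _ & Ht); [definability|].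
    apply (HS t s x).
    + apply IH, (bijection_intro M HM (fun u v => related f u v /\ u <> x)).
      * definability.
      * intros u Hu; apply Ht in Hu; destruct Hu as [Hu Hux].
        destruct (Htot u Hu) as [v Hv K]; exists v; [|auto].
        apply Hn' in Hv; destruct Hv as [Hv| ->]; [trivial|].
        destruct Hux; eauto.
      * intros v Hv; destruct (Hsurj v) as [u Hu K]; [apply Hn'; auto|].
        assert (u <> x).
        { intros ->; apply (mem_irrefl n).
          now rewrite <- (Hfun x v n) at 1. }
        exists u; [apply Ht|]; auto.
      * intros u v v' [K _] [K' _]; eauto.
      * intros u u' v [K _] [K' _]; eauto.
    + intros u; rewrite Ht; destruct (classic (u = x)) as [->|]; tauto.
Qed.

Lemma finite_subset s s' : finite omega s -> subset s' s -> finite omega s'.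
Proof.
  intros Hs; revert s'; revert s Hs; refine (finite_induction _ _ _ _).
  - definability.
  - intros s Hs s' K; apply finite_empty; intros u Hu; apply (Hs u), K, Hu.
  - intros s t x IH Ht s' Hs'.
    destruct (comprehension M HM (fun u => u <> x) s') as (a & _ & Ha); [definability|].
    assert (Hfin : finite omega a).
    { apply IH; intros u Hu; apply Ha in Hu; destruct Hu as [Hu Hux].
      apply Hs', Ht in Hu; tauto. }
    destruct (classic (x ∈ s')) as [Hx|Hx].
    + apply (finite_add a s' x Hfin); intros u; rewrite Ha.
      destruct (classic (u = x)) as [->|]; tauto.
    + apply IH; intros u Hu; assert (K := Hs' u Hu); apply Ht in K.
      destruct K as [K| ->]; tauto.
Qed.

Lemma finite_minimum d r s : finite omega s ->
  (forall x y, x ∈ d -> y ∈ d -> related r x y \/ related r y x) ->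
  (forall x y z, related r x y -> related r y z -> related r x z) ->
  subset s d -> (exists x, x ∈ s) -> exists2 x, x ∈ s & forall y, y ∈ s -> related r x y.
Proof.
  intros Hs Htot Htrans; revert s Hs; refine (finite_induction _ _ _ _).
  - definability.
  - intros s Hs _ [x Hx]; now apply Hs in Hx.
  - intros s s' x IH H Hd _.
    assert (Hxd : x ∈ d) by (apply Hd, H; auto).
    assert (Hsd : subset s d) by (intros u Hu; apply Hd, H; auto).
    assert (Hxx : related r x x) by (destruct (Htot x x); auto).
    destruct (classic (exists u, u ∈ s)) as [Hne|Hne].
    + destruct (IH Hsd Hne) as [u Hu Hmin].
      destruct (Htot u x) as [K|K]; auto.
      * exists u; [apply H; auto|]; intros y Hy; apply H in Hy.
        destruct Hy as [Hy| ->]; auto.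
      * exists x; [apply H; auto|]; intros y Hy; apply H in Hy.
        destruct Hy as [Hy| ->]; eauto.
    + exists x; [apply H; auto|]; intros y Hy; apply H in Hy.
      destruct Hy as [Hy| ->]; [destruct Hne; eauto|trivial].
Qed.

End Finite.

(** * Fixed points of deflationary operations *)

(** The intersection of [S], relative to [R0]: for empty [S] it is [R0], so that a
    family closed under these intersections contains the starting point. *)
Definition is_meet {M : structure} (R0 S R : M) : Prop :=
  isset R /\ forall p : M, p ∈ R <-> p ∈ R0 /\ forall C : M, C ∈ S -> p ∈ C.

Definition is_chain {M : structure} (S : M) : Prop :=
  forall C D : M, C ∈ S -> D ∈ S -> subset C D \/ subset D C.

Section Tower.

Variables (M : structure) (HM : ZFA M) (R0 : M) (step : M -> M -> Prop).
Implicit Types (C D F R S p : M).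

Hypothesis step_definable : definable2 step.
Hypothesis step_exists : forall R, exists R', step R R'.
Hypothesis step_isset : forall R R', step R R' -> isset R'.
Hypothesis step_subset : forall R R', step R R' -> subset R' R.
Hypothesis step_unique : forall R R' R'', step R R' -> step R R'' -> R' = R''.

Definition closed F : Prop :=
  (forall R R', R ∈ F -> step R R' -> R' ∈ F) /\
  (forall S R, subset S F -> is_meet R0 S R -> R ∈ F).

Definition is_tower F : Prop := closed F /\ forall F', closed F' -> subset F F'.

Lemma meet_exists S : exists R, is_meet R0 S R.
Proof.
  destruct (comprehension M HM (fun p => forall C, C ∈ S -> p ∈ C) R0) as (R & HR & H).
  - definability.
  - exists R; now split.
Qed.

Lemma powerset_closed F : (forall R, R ∈ F <-> isset R /\ subset R R0) -> closed F.
Proof.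
  intros HF; split.
  - intros R R' HR Hstep; apply HF in HR; apply HF; split.
    + now apply (step_isset R).
    + intros p Hp; exact (proj2 HR p (step_subset R R' Hstep p Hp)).
  - intros S R _ [Hset HR]; apply HF; split; trivial.
    intros p Hp; exact (proj1 (proj1 (HR p) Hp)).
Qed.

Lemma tower_exists : exists F, is_tower F.
Proof.
  destruct (zfa_power HM R0) as [Q HQ].
  destruct (comprehension M HM (fun R => forall F, closed F -> R ∈ F) Q) as (F & _ & HF).
  { definability. }
  exists F; split; [split|].
  - intros R R' HR Hstep; apply HF in HR; apply HF; split.
    + now apply (proj1 (powerset_closed Q HQ) R).
    + intros G HG; apply (proj1 HG R R'); trivial; now apply HR.
  - intros S R HS HR; apply HF; split.
    + apply (proj2 (powerset_closed Q HQ) S); trivial.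
      intros C HC; apply HS, HF in HC; tauto.
    + intros G HG; apply (proj2 HG S R); trivial; intros C HC.
      now apply HS, HF in HC; apply HC.
  - intros G HG R HR; now apply HF in HR; apply HR.
Qed.

Lemma tower_member F R : is_tower F -> R ∈ F -> isset R /\ subset R R0.
Proof.
  intros HF HR; destruct (zfa_power HM R0) as [Q HQ].
  now apply HQ, (proj2 HF Q (powerset_closed Q HQ)).
Qed.

Lemma tower_induction F (P : M -> Prop) : is_tower F -> definable (fun e => P (e 0)) ->
  (forall R R', R ∈ F -> P R -> step R R' -> P R') ->
  (forall S R, subset S F -> (forall C, C ∈ S -> P C) -> is_meet R0 S R -> P R) ->
  forall R, R ∈ F -> P R.
Proof.
  intros HF HP Hstep Hmeet R HR.
  destruct (comprehension M HM P F HP) as (G & _ & HG).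
  apply HG; revert R HR; apply (proj2 HF); split.
  - intros R R' HR K; apply HG in HR; apply HG; split.
    + apply (proj1 (proj1 HF) R); tauto.
    + apply (Hstep R); tauto.
  - intros S R HS HR; assert (HSF : subset S F).
    { intros C HC; apply HS, HG in HC; tauto. }
    apply HG; split.
    + now apply (proj2 (proj1 HF) S).
    + apply (Hmeet S); trivial; intros C HC; apply HS, HG in HC; tauto.
Qed.

(** The property of [C] from which its comparability with the whole tower follows
    by induction: [step] cannot jump over [C]. *)
Definition extreme F C : Prop :=
  forall R R', R ∈ F -> subset C R -> R <> C -> step R R' -> subset C R'.

(** The members above [C] and those below its successor [C'] form a closed family:
    [step] does not jump over [C], and it takes [C] itself to [C'].  An
    intersection is below [C'] as soon as one of the sets is. *)
Lemma extreme_comparable F C C' : is_tower F -> C ∈ F -> extreme F C -> step C C' ->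
  forall R, R ∈ F -> subset R C' \/ subset C R.
Proof.
  intros HF HC Hext HC'; refine (tower_induction _ _ HF _ _ _); [definability| |].
  - intros R R' HR [K|K] Hstep.
    + left; intros p Hp; now apply K, (step_subset R R').
    + destruct (classic (R = C)) as [->|Hne].
      * left; now rewrite (step_unique C R' C').
      * right; now apply (Hext R R').
  - intros S R HS IH [_ HR].
    destruct (classic (exists2 D, D ∈ S & subset D C')) as [[D HD K]|Hno].
    + left; intros p Hp; apply K, HR; trivial.
    + right; intros p Hp; apply HR; split.
      * now apply (tower_member F C).
      * intros D HD; destruct (IH D HD) as [K|K]; auto.
        destruct Hno; eauto.
Qed.

(** For an intersection [C] of extreme sets, a member [R] strictly above [C] fails
    to be contained in some [D] of them; comparability with [D] places [R]
    strictly above [D], and [D] is extreme. *)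
Lemma tower_extreme F : is_tower F -> forall C, C ∈ F -> extreme F C.
Proof.
  intros HF; refine (tower_induction _ _ HF _ _ _); [definability| |].
  - intros C C' HC IH HC' R R' HR Hsub Hne HR'.
    destruct (extreme_comparable F C C' HF HC IH HC' R HR) as [K|K].
    + destruct Hne; apply (set_ext M HM); trivial.
      * now apply (tower_member F R).
      * now apply (step_isset C).
    + destruct (classic (R = C)) as [->|Hne'].
      * now rewrite (step_unique C R' C').
      * intros p Hp; apply (IH R R'); trivial; now apply (step_subset C C').
  - intros S C HS IH HC R R' HR Hsub Hne HR'.
    destruct (classic (exists2 D, D ∈ S & ~ subset R D)) as [[D HD K]|Hno].
    + destruct (step_exists D) as [D' HD'].
      assert (HCD : subset C D) by (intros p Hp; now apply HC).
      destruct (extreme_comparable F D D' HF (HS D HD) (IH D HD) HD' R HR) as [J|J].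
      * destruct K; intros p Hp; now apply (step_subset D D'), J.
      * intros p Hp; apply (IH D HD R R'); auto.
        intros ->; now apply K.
    + destruct Hne; apply (set_ext M HM); trivial.
      * now apply (tower_member F R).
      * apply HC.
      * intros p Hp; apply HC; split; [now apply (tower_member F R)|].
        intros D HD; apply NNPP; intros K; apply Hno; exists D; auto.
Qed.

Lemma tower_chain F : is_tower F -> is_chain F.
Proof.
  intros HF C R HC HR; destruct (step_exists C) as [C' HC'].
  destruct (extreme_comparable F C C' HF HC (tower_extreme F HF C HC) HC' R HR) as [K|K];
    auto.
  right; intros p Hp; now apply (step_subset C C'), K.
Qed.

(** The intersection of the tower is its least member, so [step], which decreases
    and stays in the tower, cannot change it.  The property [P] only has to be
    preserved by intersections of chains because the tower is one. *)
Theorem deflationary_fixpoint (P : M -> Prop) : definable (fun e => P (e 0)) ->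
  (forall R R', subset R R0 -> P R -> step R R' -> P R') ->
  (forall S R, is_chain S -> (forall C, C ∈ S -> subset C R0 /\ P C) ->
     is_meet R0 S R -> P R) ->
  exists R, subset R R0 /\ P R /\ step R R.
Proof.
  intros HP Hstep Hmeet; destruct tower_exists as [F HF].
  assert (HPF : forall R, R ∈ F -> P R).
  { refine (tower_induction F P HF HP _ _).
    - intros R R' HR; apply Hstep; now apply (tower_member F R).
    - intros S R HS IH HR; apply (Hmeet S R); trivial.
      + intros C D HC HD; apply (tower_chain F HF); auto.
      + intros C HC; split; auto; apply (tower_member F C); auto. }
  destruct (meet_exists F) as [R HR].
  assert (HRF : R ∈ F) by (apply (proj2 (proj1 HF) F); trivial; now intros C).
  destruct (step_exists R) as [R' HR'].
  exists R; split; [now apply (tower_member F R)|split; [now apply HPF|]].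
  replace R with R' at 2; trivial.
  apply (set_ext M HM).
  - now apply (step_isset R).
  - apply HR.
  - now apply step_subset.
  - intros p Hp; apply HR; trivial; now apply (proj1 (proj1 HF) R).
Qed.

End Tower.

(** * Refinement by successor counts *)

Section Refinement.

Variables (M : structure) (HM : ZFA M) (omega : M) (Homega : is_omega omega).
Implicit Types (k l m n p r s u v w x y z R : M).

(** [d] is the set of nodes, [lev x k] says that [x] has level [k], and
    [succ x y] that [y] is a successor of [x]. *)
Variables (d : M) (lev succ : M -> M -> Prop).
Hypothesis lev_definable : definable2 lev.
Hypothesis succ_definable : definable2 succ.
Hypothesis lev_exists : forall x, x ∈ d -> exists2 k, k ∈ omega & lev x k.
Hypothesis lev_unique : forall x k k', k ∈ omega -> k' ∈ omega ->
  lev x k -> lev x k' -> k = k'.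
Hypothesis lev_finite : forall k, k ∈ omega ->
  exists2 l, finite omega l & forall x, x ∈ d -> lev x k -> x ∈ l.

Definition equiv R x y : Prop := related R x y /\ related R y x.

Definition below R x y : Prop := related R x y /\ ~ related R y x.

Definition count R x z n : Prop :=
  n ∈ omega /\ exists s, has_card s n /\
    forall u, u ∈ s <-> u ∈ d /\ equiv R u z /\ succ x u.

(** For finite sets this says that [x] has at most as many successors as [y] in
    the class of [z].  It is a condition on every [n] that counts the successors
    of [y], so that totality and transitivity follow directly from the order of
    the natural numbers. *)
Definition count_le R x y z : Prop :=
  forall n, count R y z n -> exists2 m, le_nat M m n & count R x z m.

Definition agree R x y z : Prop := count_le R x y z /\ count_le R y x z.

(** Lexicographic comparison, in a form that does not mention a first difference:
    at every class before which [x] and [y] agree, [x] has at most the count of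
    [y].  Well-foundedness then enters only in transitivity and antisymmetry. *)
Definition lex_le R x y : Prop :=
  forall z, z ∈ d -> (forall w, w ∈ d -> below R w z -> agree R x y w) ->
    count_le R x y z.

(** Since [step] only removes pairs of equivalent nodes, nodes once separated keep
    their order. *)
Definition step R R' : Prop :=
  isset R' /\ forall p, p ∈ R' <-> p ∈ R /\
    exists x y, is_opair p x y /\ (related R y x -> lex_le R x y).

Definition level_le x y : Prop :=
  exists j k, j ∈ omega /\ k ∈ omega /\ lev x j /\ lev y k /\ le_nat M j k.

Definition total_preorder R : Prop :=
  (forall x y, x ∈ d -> y ∈ d -> related R x y \/ related R y x) /\
  (forall x y z, related R x y -> related R y z -> related R x z).

Lemma step_definable : definable2 step.
Proof. definability. Qed.

Lemma step_exists R : exists R', step R R'.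
Proof.
  destruct (comprehension M HM (fun p => exists x y, is_opair p x y /\
    (related R y x -> lex_le R x y)) R) as (R' & Hset & HR').
  - definability.
  - exists R'; now split.
Qed.

Lemma step_related R R' x y : step R R' ->
  (related R' x y <-> related R x y /\ (related R y x -> lex_le R x y)).
Proof.
  intros [_ H]; destruct (opair_exists M HM x y) as [p Hp].
  rewrite <- !(opair_related M HM _ p x y Hp), H; split.
  - intros [Hx (x' & y' & Hp' & K)]; split; trivial.
    destruct (opair_inj M HM p x y x' y' Hp Hp') as [-> ->]; trivial.
  - intros [Hx K]; split; trivial; now exists x, y.
Qed.

Lemma count_le_trans R x y v z : count_le R x y z -> count_le R y v z -> count_le R x v z.
Proof.
  intros H K n Hn; destruct (K n Hn) as [m Hmn Hm], (H m Hm) as [k Hkm Hk].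
  exists k; trivial; eapply (le_nat_trans M HM omega Homega); eauto; apply Hn.
Qed.

Lemma count_le_total R x y z : count_le R x y z \/ count_le R y x z.
Proof.
  destruct (classic (count_le R x y z)) as [|H]; auto; right.
  intros m Hm; apply NNPP; intros K; apply H; intros n Hn; exists m; trivial.
  destruct (le_nat_total M HM omega Homega m n) as [|J]; trivial.
  - apply Hm.
  - apply Hn.
  - destruct K; eauto.
Qed.

Lemma agree_sym R x y z : agree R x y z -> agree R y x z.
Proof. now intros []. Qed.

Lemma agree_trans R x y v z : agree R x y z -> agree R y v z -> agree R x v z.
Proof. intros [] []; split; eapply count_le_trans; eauto. Qed.

Section RefinedPreorder.

Variables (R0 R : M).
Hypothesis HR0 : forall x y, related R0 x y <-> x ∈ d /\ y ∈ d /\ level_le x y.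
Hypothesis HRsub : forall x y, related R x y -> related R0 x y.
Hypothesis HR : total_preorder R.

Lemma related_nodes x y : related R x y -> x ∈ d /\ y ∈ d.
Proof. intros H; apply HRsub, HR0 in H; tauto. Qed.

Lemma equiv_level x y k : k ∈ omega -> equiv R x y -> lev x k -> lev y k.
Proof.
  intros Hk [H K] Hlev; apply HRsub, HR0 in H; apply HRsub, HR0 in K.
  destruct H as (_ & _ & i & j & Hi & Hj & Hxi & Hyj & Hij).
  destruct K as (_ & _ & j' & i' & Hj' & Hi' & Hyj' & Hxi' & Hji).
  rewrite (lev_unique x i' k), (lev_unique y j' j) in Hji by trivial.
  rewrite (lev_unique x i k) in Hij by trivial.
  now rewrite (le_nat_antisym M HM omega Homega k j).
Qed.

(** The preorder is well-founded: among the nodes in question take those of least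
    level, of which there are finitely many, and a minimum of these. *)
Lemma preorder_minimum (P : M -> Prop) : definable (fun e => P (e 0)) ->
  (exists2 x, x ∈ d & P x) ->
  exists x, x ∈ d /\ P x /\ forall y, y ∈ d -> P y -> related R x y.
Proof.
  intros HP [x0 Hx0 HPx0].
  destruct (comprehension M HM P d HP) as (s & _ & Hs).
  destruct (least_number M HM omega Homega (fun k => exists2 x, x ∈ s & lev x k))
    as (k & Hk & [x1 Hx1 Hlev1] & Hleast).
  { definability. }
  { destruct (lev_exists x0 Hx0) as [k Hk K]; exists k; trivial; exists x0; trivial.
    apply Hs; auto. }
  destruct (comprehension M HM (fun x => lev x k) s) as (t & _ & Ht).
  { definability. }
  assert (Htd : subset t d) by (intros x Hx; apply Ht in Hx; apply Hs; tauto).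
  destruct (lev_finite k Hk) as [l Hl Hlk].
  destruct (finite_minimum M HM omega Homega d R t) as [x Hx Hmin].
  - apply (finite_subset M HM omega Homega l); trivial.
    intros x Hx; apply Hlk; [now apply Htd|apply Ht in Hx; tauto].
  - apply HR.
  - apply HR.
  - trivial.
  - exists x1; apply Ht; auto.
  - apply Ht in Hx; destruct Hx as [Hxs Hxk]; assert (Hx := Hxs); apply Hs in Hx.
    exists x; split; [tauto|split; [tauto|]].
    intros y Hy HPy; assert (Hys : y ∈ s) by (apply Hs; auto).
    destruct (lev_exists y Hy) as [j Hj Hyj].
    destruct (proj1 HR x y) as [K|K]; try tauto.
    (* If [y] precedes [x], then [y] has the same level, hence is in [t]. *)
    apply Hmin, Ht; split; trivial.
    apply HRsub, HR0 in K; destruct K as (_ & _ & j' & k' & Hj' & Hk' & Hyj' & Hxk' & Hle).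
    rewrite (lev_unique x k' k) in Hle by tauto.
    rewrite (le_nat_antisym M HM omega Homega k j'); trivial.
    apply Hleast; eauto.
Qed.

Lemma first_disagreement x y : (exists2 w, w ∈ d & ~ agree R x y w) ->
  exists z, z ∈ d /\ ~ agree R x y z /\
    forall w, w ∈ d -> below R w z -> agree R x y w.
Proof.
  intros H; destruct (preorder_minimum (fun w => ~ agree R x y w)) as (z & Hz & K & Hmin).
  - definability.
  - trivial.
  - exists z; split; [trivial|split; [trivial|]].
    intros w Hw [_ J]; apply NNPP; intros Hna; apply J; auto.
Qed.

Lemma lex_le_agree x y : lex_le R x y -> lex_le R y x -> forall z, z ∈ d -> agree R x y z.
Proof.
  intros H K z Hz; apply NNPP; intros Hna.
  destruct (first_disagreement x y) as (z' & Hz' & J & Hbelow); [eauto|].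
  apply J; split; [now apply H|apply K; trivial].
  intros w Hw Hwz; now apply agree_sym, Hbelow.
Qed.

Lemma count_equiv x z z' n : equiv R z z' -> count R x z n -> count R x z' n.
Proof.
  intros [Hz Hz'] [Hn (s & Hcard & Hs)]; split; trivial; exists s; split; trivial.
  intros u; rewrite Hs; unfold equiv; destruct HR as [_ Htrans].
  split; intros (? & [] & ?); repeat split; eauto.
Qed.

(** If the comparison of [x] with [y] fails at [z'], then they disagree at [z'], so
    no class before which they agree lies after [z']; before [z'] they agree, and
    at [z'] itself the counts compare the other way. *)
Lemma lex_le_total x y : lex_le R x y \/ lex_le R y x.
Proof.
  destruct (classic (lex_le R x y)) as [|H]; auto; right.
  intros z Hz Hbelow.
  assert (exists z', z' ∈ d /\ (forall w, w ∈ d -> below R w z' -> agree R x y w) /\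
            ~ count_le R x y z') as (z' & Hz' & Hbelow' & Hnle).
  { apply NNPP; intros K; apply H; intros z' Hz' Hb; apply NNPP; intros J.
    apply K; now exists z'. }
  destruct (classic (related R z z')) as [K|K], (classic (related R z' z)) as [K'|K'].
  - intros n Hn; destruct (count_le_total R x y z') as [|J]; [easy|].
    destruct (J n) as [m Hm J']; [now apply (count_equiv x z)|].
    exists m; trivial; now apply (count_equiv y z').
  - apply Hbelow'; [trivial|now split].
  - destruct Hnle; apply (Hbelow z'); [trivial|now split].
  - destruct (proj1 HR z z'); tauto.
Qed.

(** Suppose that [x] and [v] agree before [z].  If [x] and [y] disagreed before [z],
    then at their first disagreement the count would grow strictly from [x] to
    [y] and not shrink from [y] to [v].  So all three agree before [z]. *)
Lemma lex_le_trans x y v : lex_le R x y -> lex_le R y v -> lex_le R x v.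
Proof.
  intros H K z Hz Hbelow.
  assert (Hxy : forall w, w ∈ d -> below R w z -> agree R x y w).
  { intros w0 Hw0 Hw0z; apply NNPP; intros Hna.
    destruct (preorder_minimum (fun w => below R w z /\ ~ agree R x y w))
      as (w & Hw & [Hwz Hnw] & Hmin).
    { definability. }
    { eauto. }
    assert (Hxyw : forall u, u ∈ d -> below R u w -> agree R x y u).
    { intros u Hu [Huw Hwu]; apply NNPP; intros Hnu; apply Hwu, Hmin; trivial.
      destruct HR as [_ Htrans], Hwz; repeat split; eauto. }
    (* At [w] the counts of [x], [y], [v] increase weakly, and those of [x] and [v]
       agree; so those of [x] and [y] agree. *)
    apply Hnw; split; [now apply H|].
    apply (count_le_trans R y v x); [|now apply Hbelow].
    apply K; trivial; intros u Hu Huw.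
    apply (agree_trans R y x v); [now apply agree_sym, Hxyw|].
    apply Hbelow; trivial.
    destruct HR as [_ Htrans], Hwz, Huw; repeat split; eauto. }
  apply (count_le_trans R x y v); [now apply H|].
  apply K; trivial; intros w Hw Hwz.
  apply (agree_trans R y x v); [now apply agree_sym, Hxy|now apply Hbelow].
Qed.

Lemma count_exists x z : x ∈ d -> z ∈ d -> exists n, count R x z n.
Proof.
  intros Hx Hz.
  destruct (comprehension M HM (fun u => equiv R u z /\ succ x u) d) as (s & _ & Hs).
  { definability. }
  destruct (lev_exists z Hz) as [k Hk Hzk], (lev_finite k Hk) as [l Hl Hlk].
  destruct (finite_subset M HM omega Homega l s) as [n Hn Hcard]; trivial.
  - intros u Hu; apply Hs in Hu; destruct Hu as (Hu & [Huz Hzu] & _).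
    apply Hlk; trivial; now apply (equiv_level z).
  - exists n; split; trivial; now exists s.
Qed.

Lemma step_total_preorder R' : step R R' -> total_preorder R'.
Proof.
  intros Hstep; destruct HR as [Htot Htrans]; split.
  - intros x y Hx Hy; rewrite !(step_related R R') by trivial.
    destruct (lex_le_total x y), (Htot x y); trivial; 
      destruct (classic (related R x y)), (classic (related R y x)); tauto.
  - intros x y z; rewrite !(step_related R R') by trivial.
    intros [Hxy Kxy] [Hyz Kyz]; split; [eauto|intros Hzx].
    apply (lex_le_trans x y z); eauto.
Qed.

(** At a fixed point equivalent nodes are lexicographically below each other, so
    their counts agree.  The common number is the least one that counts the
    successors of [x]: agreement bounds, in both directions, the least numbers for
    equivalent nodes by each other. *)
Lemma fixed_uniform_count x z : step R R -> x ∈ d -> z ∈ d ->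
  exists n, forall x', equiv R x x' -> count R x' z n.
Proof.
  intros Hstep Hx Hz; destruct (count_exists x z Hx Hz) as [n0 Hn0].
  destruct (least_number M HM omega Homega (count R x z)) as (n & Hn & Hcount & Hleast).
  { definability. }
  { exists n0; trivial; apply Hn0. }
  exists n; intros x' [H H'].
  assert (K := proj2 (proj1 (step_related R R x x' Hstep) H) H').
  assert (K' := proj2 (proj1 (step_related R R x' x Hstep) H') H).
  destruct (lex_le_agree x x' K K' z Hz) as [J J'].
  destruct (J' n Hcount) as [m Hmn Hm], (J m Hm) as [m' Hmm' Hm'].
  assert (E : m = n); [|now rewrite <- E].
  apply (le_nat_antisym M HM omega Homega); trivial.
  apply (le_nat_trans M HM omega Homega n m' m); trivial; [apply Hm|].
  apply Hleast; trivial; apply Hm'.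
Qed.

End RefinedPreorder.

Lemma level_total_preorder R0 :
  (forall x y, related R0 x y <-> x ∈ d /\ y ∈ d /\ level_le x y) -> total_preorder R0.
Proof.
  intros HR0; split.
  - intros x y Hx Hy; rewrite !HR0.
    destruct (lev_exists x Hx) as [j Hj Hxj], (lev_exists y Hy) as [k Hk Hyk].
    destruct (le_nat_total M HM omega Homega j k Hj Hk) as [K|K]; [left|right];
      repeat split; trivial; [exists j, k|exists k, j]; auto.
  - intros x y z; rewrite !HR0.
    intros (Hx & Hy & i & j & Hi & Hj & Hxi & Hyj & Hij)
      (_ & Hz & j' & k & Hj' & Hk & Hyj' & Hzk & Hjk).
    repeat split; trivial; exists i, k; repeat split; trivial.
    rewrite (lev_unique y j' j) in Hjk by trivial.
    now apply (le_nat_trans M HM omega Homega i j k).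
Qed.

(** The chain condition is what makes the intersection total: if one member [C]
    omits the pair [(x, y)], then [C] contains [(y, x)], and so does every other
    member, whether it includes [C] or is included in it. *)
Lemma meet_total_preorder R0 S R : total_preorder R0 -> is_chain S ->
  (forall C, C ∈ S -> subset C R0 /\ total_preorder C) -> is_meet R0 S R ->
  total_preorder R.
Proof.
  intros [Htot0 Htrans0] Hchain HS [_ HR].
  assert (Hrel : forall x y, related R x y <->
            related R0 x y /\ forall C, C ∈ S -> related C x y).
  { intros x y; destruct (opair_exists M HM x y) as [p Hp].
    rewrite <- (opair_related M HM R p x y Hp), HR, <- (opair_related M HM R0 p x y Hp).
    apply and_iff_compat_l; split; intros K C HC;
      apply (opair_related M HM C p x y Hp); auto. }
  split.
  - intros x y Hx Hy; rewrite !Hrel.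
    destruct (classic (related R0 x y)) as [K0|K0].
    + destruct (classic (exists2 C, C ∈ S & ~ related C x y)) as [[C HC K]|Hno].
      * right; destruct (proj1 (proj2 (HS C HC)) x y Hx Hy) as [|J]; [easy|].
        split; [apply (related_subset M C); trivial; now apply HS|].
        intros D HD; destruct (Hchain C D HC HD) as [HCD|HDC].
        -- now apply (related_subset M C).
        -- destruct (proj1 (proj2 (HS D HD)) x y Hx Hy) as [J'|]; trivial.
           destruct K; now apply (related_subset M D).
      * left; split; trivial; intros C HC; apply NNPP; intros K; apply Hno; eauto.
    + right; split; [destruct (Htot0 x y); tauto|].
      intros C HC; destruct (proj1 (proj2 (HS C HC)) x y Hx Hy) as [J|]; trivial.
      destruct K0; apply (related_subset M C); trivial; now apply HS.
  - intros x y z; rewrite !Hrel; intros [Hxy Kxy] [Hyz Kyz]; split; [eauto|].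
    intros C HC; apply (proj2 (proj2 (HS C HC)) x y z); auto.
Qed.

Theorem stable_preorder_exists : exists R,
  total_preorder R /\
  (forall x y k, k ∈ omega -> equiv R x y -> lev x k -> lev y k) /\
  (forall x y, related R x y -> x ∈ d /\ y ∈ d) /\
  (forall x z, x ∈ d -> z ∈ d -> exists n, forall x', equiv R x x' -> count R x' z n).
Proof.
  destruct (relation_comprehension M HM level_le d d) as (R0 & _ & _ & HR0).
  { definability. }
  destruct (deflationary_fixpoint M HM R0 step) with (P := total_preorder)
    as (R & HRsub & HR & Hstep).
  - apply step_definable.
  - apply step_exists.
  - now intros R R' [].
  - intros R R' [_ H] p Hp; now apply H.
  - intros R R' R'' [Hset H] [Hset' H']; apply (set_ext M HM); trivial;
      intros p Hp; [apply H', H|apply H, H']; trivial.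
  - definability.
  - intros R R' K HR; apply (step_total_preorder R0 R); eauto using related_subset.
  - intros S R HS HC HR; apply (meet_total_preorder R0 S R); trivial.
    now apply level_total_preorder.
  - exists R; split; [trivial|split; [|split]].
    + intros x y k; apply (equiv_level R0); eauto using related_subset.
    + intros x y; apply (related_nodes R0); eauto using related_subset.
    + intros x z; apply (fixed_uniform_count R0); eauto using related_subset.
Qed.

End Refinement.

(** * Ordered partitions from a preorder *)

Section Pieces.

Variables (M : structure) (HM : ZFA M) (d R : M).
Implicit Types (a p q r s x y z l P X Y lt : M).
Hypothesis HR : total_preorder M d R.
Hypothesis Hnodes : forall x y, related R x y -> x ∈ d /\ y ∈ d.

Definition is_class x X : Prop := isset X /\ forall y, y ∈ X <-> equiv M R x y.

Definition is_quotient l P : Prop :=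
  isset P /\ forall X, X ∈ P <-> exists2 x, x ∈ l & is_class x X.

Definition is_quotient_order P lt : Prop :=
  relation_on P lt /\ forall X Y, related lt X Y <->
    X ∈ P /\ Y ∈ P /\ exists x y, x ∈ X /\ y ∈ Y /\ below M R x y.

Lemma equiv_refl x : x ∈ d -> equiv M R x x.
Proof. intros Hx; destruct HR as [Htot _]; destruct (Htot x x Hx Hx); now split. Qed.

Lemma equiv_sym x y : equiv M R x y -> equiv M R y x.
Proof. now intros []. Qed.

Lemma equiv_trans x y z : equiv M R x y -> equiv M R y z -> equiv M R x z.
Proof. destruct HR as [_ Htrans]; intros [] []; split; eauto. Qed.

Lemma class_exists x : exists X, is_class x X.
Proof.
  destruct (comprehension M HM (fun y => equiv M R x y) d) as (X & Hset & HX).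
  { definability. }
  exists X; split; trivial; intros y; rewrite HX; split; [tauto|].
  intros H; split; trivial; now apply (Hnodes x y), H.
Qed.

Lemma class_unique x y X Y : equiv M R x y -> is_class x X -> is_class y Y -> X = Y.
Proof.
  intros H [HX KX] [HY KY]; apply (set_ext M HM); trivial.
  - intros u Hu; apply KX in Hu; apply KY.
    apply (equiv_trans y x); [now apply equiv_sym|trivial].
  - intros u Hu; apply KY in Hu; apply KX; now apply (equiv_trans x y).
Qed.

Lemma quotient_exists l : subset l d -> exists P, is_quotient l P.
Proof.
  intros Hl; destruct (replacement M HM is_class l) as (P & Hset & HP).
  - definability.
  - intros x X X' Hx; apply class_unique, equiv_refl, Hl, Hx.
  - now exists P.
Qed.

Lemma quotient_unique l P P' : is_quotient l P -> is_quotient l P' -> P = P'.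
Proof.
  intros [HP K] [HP' K']; apply (set_ext M HM); trivial; intros X HX;
    [apply K', K|apply K, K']; trivial.
Qed.

Lemma quotient_order_exists P : exists lt, is_quotient_order P lt.
Proof.
  destruct (relation_comprehension M HM (fun X Y => exists x y,
    x ∈ X /\ y ∈ Y /\ below M R x y) P P) as (lt & Hset & Hp & Hlt).
  - definability.
  - exists lt; split; [now split|trivial].
Qed.

Lemma relation_ext a r r' : relation_on a r -> relation_on a r' ->
  (forall x y, related r x y <-> related r' x y) -> r = r'.
Proof.
  intros [Hset Hr] [Hset' Hr'] H; apply (set_ext M HM); trivial; intros p Hp.
  - destruct (Hr p Hp) as (x & y & _ & _ & K).
    apply (opair_related M HM r' p x y K), H; now exists p.
  - destruct (Hr' p Hp) as (x & y & _ & _ & K).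
    apply (opair_related M HM r p x y K), H; now exists p.
Qed.

Lemma quotient_order_unique P lt lt' :
  is_quotient_order P lt -> is_quotient_order P lt' -> lt = lt'.
Proof.
  intros [H K] [H' K']; apply (relation_ext P); trivial.
  intros X Y; now rewrite K, K'.
Qed.

Lemma quotient_partition l P : subset l d ->
  (forall x y, x ∈ l -> equiv M R x y -> y ∈ l) ->
  is_quotient l P -> partition l P.
Proof.
  intros Hl Hclosed [Hset HP]; split; [trivial|split].
  - intros X HX; apply HP in HX; destruct HX as [x Hx [_ HX]]; split.
    + exists x; now apply HX, equiv_refl, Hl.
    + intros y Hy; apply HX in Hy; eauto.
  - intros x Hx; destruct (class_exists x) as [X HX]; exists X; split; [split|].
    + apply HP; eauto.
    + now apply HX, equiv_refl, Hl.
    + intros Y [HY Hxy]; apply HP in HY; destruct HY as [y Hy HY].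
      apply (class_unique x y); trivial; apply equiv_sym; now apply HY.
Qed.

Lemma quotient_linear_order l P lt : subset l d -> is_quotient l P ->
  is_quotient_order P lt -> strict_linear_order P lt.
Proof.
  intros Hl [Hset HP] [Hrel Hlt]; destruct HR as [Htot Htrans].
  split; [trivial|split; [|split]].
  - intros X HX; apply Hlt in HX.
    destruct HX as (HX & _ & x & y & Hx & Hy & _ & Hyx); apply Hyx.
    apply HP in HX; destruct HX as [z _ [_ HX]]; apply HX in Hx; apply HX in Hy.
    destruct Hx, Hy; eauto.
  - intros X Y Z HXY HYZ; apply Hlt in HXY; apply Hlt in HYZ; apply Hlt.
    destruct HXY as (HX & HY & x & y & Hx & Hy & Hxy & Hyx).
    destruct HYZ as (_ & HZ & y' & z & Hy' & Hz & Hyz & Hzy).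
    split; [trivial|split; [trivial|exists x, z]]; repeat split; trivial.
    all: apply HP in HY; destruct HY as [w _ [_ HY]]; apply HY in Hy; apply HY in Hy'.
    all: destruct Hy, Hy'; eauto 6.
  - intros X Y HX HY; assert (HX' := HX); assert (HY' := HY).
    apply HP in HX'; destruct HX' as [x Hx KX]; apply HP in HY'; destruct HY' as [y Hy KY].
    assert (x ∈ X) by now apply KX, equiv_refl, Hl.
    assert (y ∈ Y) by now apply KY, equiv_refl, Hl.
    destruct (classic (related R x y)) as [J|J], (classic (related R y x)) as [J'|J'].
    + right; left; apply (class_unique x y); trivial; now split.
    + left; apply Hlt; repeat split; trivial; now exists x, y.
    + right; right; apply Hlt; repeat split; trivial; now exists y, x.
    + destruct (Htot x y); auto; tauto.
Qed.

End Pieces.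

(** * Equitable ordered partitions of the levels *)

Theorem theorem4p2 (M : structure) (HM : ZFA M) (omega T le L : M)
    (Homega : is_omega omega)
    (Htree : tree T le)
    (Hlevels : omega_levels omega T le L)
    (Hfinite : forall k l : M, k ∈ omega -> related L k l -> finite omega l) :
  (* Pi maps each k to the ordered pair (pi_k, <) *)
  exists Pi : M,
    function_on omega Pi /\
    (forall k l q : M, k ∈ omega -> related L k l -> related Pi k q ->
       exists P lt : M, is_opair q P lt /\ ordered_partition l P lt) /\
    (forall k k1 q q1 P lt P1 lt1 : M,
       k ∈ omega -> is_succ k1 k ->
       related Pi k q -> is_opair q P lt ->
       related Pi k1 q1 -> is_opair q1 P1 lt1 ->
       forall X Y : M, X ∈ P -> Y ∈ P1 ->
       exists2 n : M, n ∈ omega &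
         forall x S : M, x ∈ X ->
           (forall y : M, y ∈ S <-> y ∈ Y /\ immediate_successor T le x y) ->
           has_card S n).
Proof.
  destruct Hlevels as [[w Hw [Hfun Hlevel]] _].
  assert (Hdom : forall k, k ∈ omega -> k ∈ w) by (intros k Hk; apply Hw; auto).
  assert (Lfun : forall k, k ∈ omega -> exists l, related L k l).
  { intros k Hk; destruct (proj2 (proj2 Hfun) k (Hdom k Hk)) as (l & Hl & _); eauto. }
  assert (Lunique : forall k l l', k ∈ omega -> related L k l -> related L k l' -> l = l').
  { intros k l l' Hk H H'; destruct (proj2 (proj2 Hfun) k (Hdom k Hk)) as (z & _ & Hz).
    now rewrite <- (Hz l), <- (Hz l'). }
  assert (Lunplaced : forall k l x, k ∈ omega -> related L k l -> x ∈ l ->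
            unplaced T L k x).
  { intros k l x Hk Hl Hx; now apply (Hlevel k l (Hdom k Hk) Hl). }
  pose (lev := fun x k => exists2 l, related L k l & x ∈ l).
  destruct (comprehension M HM (fun x => exists2 k, k ∈ omega & lev x k) T)
    as (d & _ & Hd); [definability|].
  assert (Hld : forall k l, k ∈ omega -> related L k l -> subset l d).
  { intros k l Hk Hl x Hx; apply Hd; split.
    - now apply (Lunplaced k l).
    - exists k; trivial; now exists l. }
  destruct (stable_preorder_exists M HM omega Homega d lev (immediate_successor T le))
    as (R & HR & Hequiv & Hnodes & Hcount).
  - definability.
  - definability.
  - intros x Hx; apply Hd in Hx; apply Hx.
  - (* An element of the level [j] is not available at any later level [k]. *)
    intros x j k Hj Hk [l Hl Hx] [l' Hl' Hx'].
    destruct (omega_linear M HM omega Homega j k Hj Hk) as [H|[H|H]]; trivial.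
    + destruct (Lunplaced k l' x) as [_ K]; trivial; destruct K; now exists j, l.
    + destruct (Lunplaced j l x) as [_ K]; trivial; destruct K; now exists k, l'.
  - intros k Hk; destruct (Lfun k Hk) as [l Hl]; exists l; [now apply (Hfinite k)|].
    intros x _ [l' Hl' Hx]; now rewrite (Lunique k l l').
  - destruct (function_of_class M HM (fun k q => exists l P lt, related L k l /\
      is_opair q P lt /\ is_quotient M R l P /\ is_quotient_order M R P lt) omega)
      as (Pi & HPi & Hrel).
    { definability. }
    { intros k Hk; destruct (Lfun k Hk) as [l Hl].
      destruct (quotient_exists M HM d R HR l (Hld k l Hk Hl)) as [P HP].
      destruct (quotient_order_exists M HM R P) as [lt Hlt].
      destruct (opair_exists M HM P lt) as [q Hq].
      exists q; split; [now exists l, P, lt|].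
      intros q' (l' & P' & lt' & Hl' & Hq' & HP' & Hlt').
      rewrite (Lunique k l' l) in HP' by trivial.
      rewrite (quotient_unique M HM R l P' P) in Hlt', Hq' by trivial.
      rewrite (quotient_order_unique M HM R P lt' lt) in Hq' by trivial.
      now apply (opair_unique M HM q q' P lt). }
    exists Pi; split; [trivial|split].
    + intros k l q Hk Hl Hq; apply Hrel in Hq.
      destruct Hq as (_ & l' & P & lt & Hl' & Hq & HP & Hlt).
      rewrite (Lunique k l' l) in HP by trivial.
      exists P, lt; split; [trivial|split].
      * apply (quotient_partition M HM d R); eauto.
        intros x y Hx Hxy; destruct (Hequiv x y k Hk Hxy) as [l2 Hl2 Hy].
        { now exists l. }
        now rewrite (Lunique k l l2).
      * apply (quotient_linear_order M HM d R HR l); eauto.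
    + intros k k1 q q1 P lt P1 lt1 Hk Hk1 Hq HqP Hq1 HqP1 X Y HX HY.
      apply Hrel in Hq; destruct Hq as (_ & l & P' & lt' & Hl & HqP' & HP & _).
      apply Hrel in Hq1; destruct Hq1 as (Hk1' & l1 & P1' & lt1' & Hl1 & HqP1' & HP1 & _).
      destruct (opair_inj M HM q P lt P' lt') as [<- _]; trivial.
      destruct (opair_inj M HM q1 P1 lt1 P1' lt1') as [<- _]; trivial.
      apply HP in HX; destruct HX as [x Hx [_ HX]].
      apply HP1 in HY; destruct HY as [z Hz [_ HY]].
      assert (Hxd : x ∈ d) by now apply (Hld k l).
      destruct (Hcount x z) as [n Hn]; trivial; [now apply (Hld k1 l1)|].
      exists n; [apply (Hn x), (equiv_refl M d R HR x Hxd)|].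
      intros x' S Hx' HS; destruct (Hn x') as [_ (s & Hcard & Hs)]; [now apply HX|].
      revert Hcard; apply (has_card_ext M HM); intros u.
      rewrite Hs, HS, HY; unfold equiv; split; [tauto|].
      intros [[Hzu Huz] Hsucc]; destruct (Hnodes z u Hzu); tauto.
Qed.
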